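(* Let $G$ be a compact group acting continuously on a compact space $M$ endowed with a $G$-invariant regular Borel measure $\mu$. Let $V$ be a finite dimensional $G$-subspace of $\mathcal{C}(M)$ with an orthogonal decomposition into irreducible $G$-subspaces $$V=\bigoplus_{k\in I_V} \bigoplus_{i=1}^{m_k} H_{k,i},$$ and let $E_k(x,y)$, $k\in I_V$, be the associated $m_k\times m_k$ matrices with entries $E_{k,ij}(x,y)=\sum_{s=1}^{d_k} e_{k,i,s}(x)\overline{e_{k,j,s}(y)}$ (notation as defined in the context). Let $F\in V^{(2)}$. Then $F$ is a $G$-invariant positive definite function if and only if there exist Hermitian positive semidefinite matrices $F_k\in\mathbb{C}^{m_k\times m_k}$, $k\in I_V$, such that $$F(x,y)=\sum_{k\in I_V} \langle F_k, \overline{E_k(x,y)}\rangle\qquad\text{for all } (x,y)\in M^2.$$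
   Context: $\mathcal{C}(M)$ is the space of continuous complex valued functions on the compact (Hausdorff) space $M$. The group action $G\times M\to M$ is continuous, and $G$ acts on $\mathcal{C}(M)$ by $(gf)(x)=f(g^{-1}x)$. The measure $\mu$ is a $G$-invariant finite regular Borel measure on $M$ such that $\langle f_1,f_2\rangle=\frac{1}{\mu(M)}\int_M f_1(x)\overline{f_2(x)}\,d\mu(x)$ is an inner product on $\mathcal{C}(M)$ (i.e. nonempty open sets have positive measure). A function $F\in\mathcal{C}(M^2)$ is positive definite if $F(x,y)=\overline{F(y,x)}$ and for all $N$, all $(x_1,\dots,x_N)\in M^N$ and all $(\alpha_1,\dots,\alpha_N)\in\mathbb{C}^N$ one has $\sum_{i,j=1}^N\alpha_iF(x_i,x_j)\overline{\alpha_j}\ge 0$. It is $G$-invariant if $F(gx,gy)=F(x,y)$ for all $g\in G$, $x,y\in M$. A $G$-subspace is a linear subspace stable under $G$. $V^{(2)}$ is the subspace of $\mathcal{C}(M^2)$ spanned by the functions $(x,y)\mapsto f_1(x)\overline{f_2(y)}$ with $f_1,f_2\in V$. In the decomposition of $V$: $(R_k)_{k}$ are pairwise non-isomorphic representatives of the irreducible finite dimensional (continuous) representations of $G$; $I_V$ is the finite set of indices $k$ for which $R_k$ occurs in $V$, with multiplicity $m_k\ge 1$; the subspaces $H_{k,i}$ are pairwise orthogonal and $H_{k,i}$ is $G$-isomorphic to $R_k$ for $1\le i\le m_k$; $d_k=\dim R_k$. For each $k,i$, $(e_{k,i,1},\dots,e_{k,i,d_k})$ is an orthonormal basis of $H_{k,i}$,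 chosen such that for all $g\in G$ and all $s,t$ the numbers $\langle g e_{k,i,s},e_{k,i,t}\rangle$ do not depend on $i$. $\overline{E_k(x,y)}$ is the entrywise complex conjugate, and $\langle A,B\rangle=\operatorname{trace}(B^*A)$ for matrices, so $\langle F_k,\overline{E_k(x,y)}\rangle=\sum_{i,j}(F_k)_{ij}E_{k,ij}(x,y)$. *)

(* Defs.v *)
From HB Require Import structures.
From mathcomp Require Import all_boot all_order all_algebra.
From mathcomp Require Import finmap complex.
From mathcomp Require Import all_classical all_reals all_analysis.

Set Implicit Arguments.
Unset Strict Implicit.
Unset Printing Implicit Defensive.

Import Order.TTheory GRing.Theory Num.Theory Num.Def.
Import numFieldNormedType.Exports.

Local Open Scope classical_set_scope.
Local Open Scope ring_scope.
Local Open Scope sesquilinear_scope.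

HB.mixin Record isTopologicalGroup (G : Type) of Topological G & Group G := {
  mulg_continuous : continuous (fun z : G * G => (z.1 * z.2)%g) ;
  invg_continuous : continuous (fun g : G => (g^-1)%g)
}.

#[short(type="topologicalGroupType")]
HB.structure Definition TopologicalGroup :=
  {G of isTopologicalGroup G & Topological G & Group G}.

(* [R[i]] itself has no canonical topology; at type [numClosedFieldType] it
   gets the one induced by the modulus. *)
Definition Cplx (R : realType) : numClosedFieldType := R[i].

(* [measurableType] requires a pointed carrier. *)
Notation borelType M := (g_sigma_algebraType (@open M)).

Section LinearAlgebra.
Context {K : fieldType} {L : lmodType K}.

Definition lin_span (S : set L) : set L :=
  [set v | exists (n : nat) (c : 'I_n -> K) (w : 'I_n -> L),
     (forall i, S (w i)) /\ v = \sum_(i < n) c i *: w i].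

Definition finite_dimensional (W : set L) : Prop :=
  exists (n : nat) (b : 'I_n -> L), W = lin_span (range b).

End LinearAlgebra.

Section GroupActions.
Context {G : groupType} {K : fieldType}.

Definition G_subspace (L : lmodType K) (a : G -> L -> L) (W : set L) : Prop :=
  submod_closed (mem W) /\ forall g v, W v -> W (a g v).

Definition G_irreducible (L : lmodType K) (a : G -> L -> L) (W : set L) :
    Prop :=
  [/\ G_subspace a W, W <> [set 0] &
    forall U, G_subspace a U -> U `<=` W -> U = [set 0] \/ U = W].

Definition G_isomorphic (L L' : lmodType K) (a : G -> L -> L)
    (a' : G -> L' -> L') (W : set L) (W' : set L') : Prop :=
  exists phi : {linear L -> L'},
    set_bij W W' phi /\ forall g v, W v -> phi (a g v) = a' g (phi v).

(* Matrices act on column vectors, from the left. *)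
Definition mx_act (d : nat) (rho : G -> 'M[K]_d) (g : G) (v : 'cV[K]_d) :
    'cV[K]_d := rho g *m v.

Definition fun_act (M T : Type) (act : G -> M -> M) (g : G) (f : M -> T) :
    M -> T := fun x => f (act (g^-1)%g x).

End GroupActions.

Section ContinuousRepresentations.
Context {R : realType} {G : topologicalGroupType}.
Local Notation C := (Cplx R).

Definition representation (d : nat) (rho : G -> 'M[C]_d) : Prop :=
  [/\ rho 1%g = 1%:M, (forall g h, rho (g * h)%g = rho g *m rho h) &
      continuous rho].

Definition irreducible_representation (d : nat) (rho : G -> 'M[C]_d) : Prop :=
  representation rho /\ G_irreducible (mx_act rho) [set: 'cV[C]_d].

Definition isomorphic_representations (d d' : nat) (rho : G -> 'M[C]_d)
    (rho' : G -> 'M[C]_d') : Prop :=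
  G_isomorphic (mx_act rho) (mx_act rho') [set: 'cV[C]_d] [set: 'cV[C]_d'].

Definition irreducible_representatives (K : choiceType) (d : K -> nat)
    (rho : forall k, G -> 'M[C]_(d k)) : Prop :=
  [/\ (forall k, irreducible_representation (rho k)),
      (forall k l, k != l -> ~ isomorphic_representations (rho k) (rho l)) &
      (forall n (sigma : G -> 'M[C]_n), irreducible_representation sigma ->
         exists k, isomorphic_representations (rho k) sigma)].

End ContinuousRepresentations.

Definition continuous_action (G : topologicalGroupType) (M : topologicalType)
    (act : G -> M -> M) : Prop :=
  [/\ (forall x, act 1%g x = x),
      (forall g h x, act (g * h)%g x = act g (act h x)) &
      continuous (fun z : G * M => act z.1 z.2)].

Section Measure.
Context {R : realType} {M : ptopologicalType}.
Variable mu : {finite_measure set (borelType M) -> \bar R}.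
Local Notation C := (Cplx R).

Definition regular_measure : Prop :=
  forall A : set (borelType M), measurable A ->
    mu A = ereal_inf [set mu U | U in [set U : set M | open U /\ A `<=` U]] /\
    mu A = ereal_sup [set mu S | S in [set S : set M | compact S /\ S `<=` A]].

Definition invariant_measure (G : Type) (act : G -> M -> M) : Prop :=
  forall g (A : set (borelType M)), measurable A -> mu (act g @` A) = mu A.

Definition positive_on_opens : Prop :=
  forall U : set M, open U -> U !=set0 -> (0 < mu U)%E.

Definition Cintegral (h : M -> C) : C :=
  Complex (\int[mu]_x complex.Re (h x)) (\int[mu]_x complex.Im (h x)).

Definition inner (f1 f2 : M -> C) : C :=
  (real_complex R (fine (mu setT)))^-1 * Cintegral (fun x => f1 x * (f2 x)^*).

End Measure.

Section FunctionSpaces.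
Context {R : realType} {G : topologicalGroupType} {M : ptopologicalType}.
Variables (mu : {finite_measure set (borelType M) -> \bar R}).
Variable act : G -> M -> M.
Local Notation C := (Cplx R).

Definition G_subspace_of_continuous (V : set (M -> C)) : Prop :=
  V `<=` [set f : M -> C | continuous f] /\ G_subspace (fun_act act) V.

Definition tensor_square (V : set (M -> C)) : set (M * M -> C) :=
  lin_span [set F | exists f1 f2 : M -> C,
    [/\ V f1, V f2 & F = fun z => f1 z.1 * (f2 z.2)^*]].

Definition positive_definite (F : M * M -> C) : Prop :=
  [/\ continuous F,
      (forall x y, F (x, y) = (F (y, x))^*) &
      forall (N : nat) (x : 'I_N -> M) (alpha : 'I_N -> C),
        0 <= \sum_(i < N) \sum_(j < N) alpha i * F (x i, x j) * (alpha j)^*].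

Definition G_invariant (F : M * M -> C) : Prop :=
  forall g x y, F (act g x, act g y) = F (x, y).

Definition occurs_in (d : nat) (rho : G -> 'M[C]_d) (V : set (M -> C)) : Prop :=
  exists W : set (M -> C), [/\ G_subspace (fun_act act) W, W `<=` V &
    G_isomorphic (mx_act rho) (fun_act act) [set: 'cV[C]_d] W].

Definition orthogonal_spaces (W W' : set (M -> C)) : Prop :=
  forall f g, W f -> W' g -> inner mu f g = 0.

Definition orthonormal_basis (n : nat) (b : 'I_n -> M -> C)
    (W : set (M -> C)) : Prop :=
  (forall s t, inner mu (b s) (b t) = (s == t)%:R) /\ W = lin_span (range b).

Section Decomposition.
Variables (V : set (M -> C)) (K : choiceType) (d : K -> nat).
Variable rho : forall k, G -> 'M[C]_(d k).
Variables (IV : {fset K}) (m : K -> nat).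
Variable H : forall k, 'I_(m k) -> set (M -> C).
Variable e : forall k, 'I_(m k) -> 'I_(d k) -> M -> C.

(* [m], [H] and [e] only matter at indices in [IV].  Directness of the sum
   is part of the orthogonality of its terms. *)
Definition orthogonal_decomposition : Prop :=
  [/\ (forall k, k \in IV <-> occurs_in (rho k) V),
      (forall k, k \in IV -> (0 < m k)%N),
      (forall k (i : 'I_(m k)), k \in IV ->
         [/\ G_subspace_of_continuous (H i),
             G_irreducible (fun_act act) (H i) &
             G_isomorphic (mx_act (rho k)) (fun_act act) [set: 'cV[C]_(d k)]
               (H i)]),
      (forall k l (i : 'I_(m k)) (j : 'I_(m l)), k \in IV -> l \in IV ->
         Tagged (fun k => 'I_(m k)) i != Tagged (fun k => 'I_(m k)) j ->
         orthogonal_spaces (H i) (H j)) &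
      V = [set \sum_(k <- IV) \sum_(i < m k) h k i | h in
             [set h : forall k, 'I_(m k) -> (M -> C) |
                forall k (i : 'I_(m k)), k \in IV -> H i (h k i)]]].

Definition adapted_bases : Prop :=
  (forall k (i : 'I_(m k)), k \in IV -> orthonormal_basis (e i) (H i)) /\
  (forall k (i j : 'I_(m k)) g s t, k \in IV ->
     inner mu (fun_act act g (e i s)) (e i t) =
     inner mu (fun_act act g (e j s)) (e j t)).

Definition zonal_mx (k : K) (x y : M) : 'M[C]_(m k) :=
  \matrix_(i < m k, j < m k) \sum_(s < d k) e i s x * (e j s y)^*.

End Decomposition.
End FunctionSpaces.

Section Matrices.
Context {R : realType}.
Local Notation C := (Cplx R).

Definition mx_inner (n : nat) (A B : 'M[C]_n) : C := \tr (B ^t conjC *m A).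

Definition hermitian_psd (n : nat) (A : 'M[C]_n) : Prop :=
  A \is hermsymmx /\
  forall v : 'cV[C]_n, 0 <= (v ^t conjC *m A *m v) 0 0.

End Matrices.

Arguments occurs_in {R G M} act {d} rho V.
Arguments orthogonal_decomposition {R G M} mu act V {K d} rho IV {m} H.
Arguments adapted_bases {R G M} mu act {K d} IV {m} H e.
Arguments zonal_mx {R M K d m} e k x y.

(* Main.v *)
(** The functions e_{k,i,s} are orthonormal, hence linearly independent, so F
    has unique coefficients A_{(k,i,s),(l,j,t)} with respect to the products
    e_{k,i,s}(x) conj(e_{l,j,t}(y)).  Since mu is invariant, G acts in each
    basis by unitary matrices, which depend on k only; invariance of F says
    that each block conj(A_{(k,i),(l,j)}) intertwines two of these matrix
    representations, and Schur's lemma leaves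
    A_{(k,i,s),(l,j,t)} = [k = l] [s = t] (F_k)_{ij}.  Linear independence also
    yields finitely many points at which the evaluation functionals span the
    dual of V, so testing positive definiteness at these points gives
    positivity of the form A, hence of every F_k. *)

Require Import Defs.
From mathcomp Require Import all_boot all_order all_algebra.
From mathcomp Require Import finmap complex.
From mathcomp Require Import all_classical all_reals all_analysis.
From mathcomp Require Import measurable_realfun.
From mathcomp Require Import ring.

Set Implicit Arguments.
Unset Strict Implicit.
Unset Printing Implicit Defensive.

Import Order.TTheory GRing.Theory Num.Theory Num.Def.
Import numFieldNormedType.Exports.

Local Open Scope classical_set_scope.
Local Open Scope ring_scope.

(** * Continuity and the inner product *)

(** Two fields occur because the real and imaginary parts map [Cplx R] to [R]; [delta] carries the
    tolerance into the field in which distances of the domain are measured. *)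
Lemma modulus_continuous (C D : numFieldType) (delta : D -> C) (f : C -> D) :
  (forall eps, 0 < eps -> 0 < delta eps) ->
  (forall x y eps, `|x - y| < delta eps -> `|f x - f y| < eps) ->
  continuous f.
Proof.
move=> delta_gt0 fP z; apply/(@cvgrPdist_lt _ _ _ (nbhs z)).
move=> eps /delta_gt0 deps.
near=> t; apply: fP; near: t.
by apply/nbhs_ballP; exists (delta eps).
Unshelve. all: by end_near. Qed.

Lemma continuous_Re (R : realType) :
  continuous (fun z : Cplx R => complex.Re z).
Proof.
apply: (@modulus_continuous (Cplx R) R (real_complex R)) => [eps|x y eps].
  by rewrite ltcR.
rewrite -raddfB -ltcR; apply: le_lt_trans; exact: normc_ge_Re.
Qed.

Lemma continuous_conjC (C : numClosedFieldType) :
  continuous (fun z : C => z^*).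
Proof.
apply: (@modulus_continuous C C id) => // x y eps.
by rewrite -rmorphB norm_conjC.
Qed.

Lemma continuous_Im (R : realType) :
  continuous (fun z : Cplx R => complex.Im z).
Proof.
apply: (@modulus_continuous (Cplx R) R (real_complex R)) => [eps|x y eps].
  by rewrite ltcR.
rewrite -raddfB -ltcR; apply: le_lt_trans.
case: (x - y) => a b; rewrite normc_def lecR /= -[leLHS]sqrtr_sqr.
by rewrite ler_wsqrtr// lerDr sqr_ge0.
Qed.

Lemma continuous_lincomb (C : numClosedFieldType) (M : topologicalType)
    (I : Type) (r : seq I) (c : I -> C)
    (f : I -> M -> C) :
  (forall i, continuous (f i)) ->
  continuous (\sum_(i <- r) c i *: f i : M -> C).
Proof.
move=> cf; elim: r => [|i r IHr].
  by rewrite big_nil => x; exact: cvg_cst.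
rewrite big_cons => x.
by apply: cvgD; [apply: cvgM; [exact: cvg_cst|exact: cf]|exact: IHr].
Qed.

Lemma continuous_mul_conj (C : numClosedFieldType) (M : topologicalType)
    (f h : M -> C) :
  continuous f -> continuous h -> continuous (fun x => f x * (h x)^*).
Proof.
move=> cf ch x; apply: cvgM; first exact: cf.
by apply: continuous_comp; [exact: ch|exact: continuous_conjC].
Qed.

(** * Integrals of continuous functions over a compact space *)

Section Integration.
Context {R : realType} {M : ptopologicalType}.
Hypothesis compact_M : compact [set: M].
Variable mu : {finite_measure set (borelType M) -> \bar R}.
Local Notation C := (Cplx R).

Lemma continuous_borel_measurable (N : ptopologicalType) (f : M -> N) :
  continuous f ->
  measurable_fun [set: borelType M] (f : borelType M -> borelType N).
Proof.
move=> cf.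
apply: (@measurability _ _ (borelType M) (borelType N) _ _ (@open N)) => //.
move=> _ [U oU <-]; rewrite setTI; apply: sub_sigma_algebra.
by move/continuousP: cf; apply.
Qed.

Lemma continuous_real_measurable (f : M -> R) :
  continuous f -> measurable_fun [set: borelType M] f.
Proof.
move=> cf; apply: (measurability _ (RGenOpens.measurableE R)).
move=> _ [_ [a [b ->]] <-]; rewrite setTI; apply: sub_sigma_algebra.
by move/continuousP: cf; apply; exact: interval_open.
Qed.

(** Compactness of [M] bounds the function, and bounded measurable functions are integrable for a
    finite measure. *)
Lemma continuous_integrable (f : M -> R) :
  continuous f -> mu.-integrable [set: borelType M] (EFin \o f).
Proof.
move=> cf; apply: measurable_bounded_integrable => //.
- exact: fin_num_fun_lty.
- exact: continuous_real_measurable.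
have cf' : {within [set: M], continuous f} by apply: continuous_subspaceT.
have /compact_bounded[B [Br fB]] := continuous_compact cf' compact_M.
by exists B; split => // y /fB yB x _; apply: yB; exists x.
Qed.

Lemma Cintegral_linear (a : C) (f g : M -> C) :
  continuous f -> continuous g ->
  Cintegral mu (fun x => a * f x + g x) = a * Cintegral mu f + Cintegral mu g.
Proof.
move=> cf cg.
have iRe h : continuous h -> mu.-integrable [set: borelType M]
    (EFin \o (fun x => complex.Re (h x : C))).
  move=> ch; apply: continuous_integrable => x.
  by apply: continuous_comp; [exact: ch|exact: continuous_Re].
have iIm h : continuous h -> mu.-integrable [set: borelType M]
    (EFin \o (fun x => complex.Im (h x : C))).
  move=> ch; apply: continuous_integrable => x.
  by apply: continuous_comp; [exact: ch|exact: continuous_Im].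
have caf : continuous (fun x => a * f x).
  by move=> x; apply: cvgM; [exact: cvg_cst|exact: cf].
have intD (u v : M -> R) : mu.-integrable [set: borelType M] (EFin \o u) ->
    mu.-integrable [set: borelType M] (EFin \o v) ->
    \int[mu]_x (u x + v x) = \int[mu]_x u x + \int[mu]_x v x.
  by move=> iu iv; rewrite RintegralD.
have intZ (c : R) (u : M -> R) :
    mu.-integrable [set: borelType M] (EFin \o u) ->
    mu.-integrable [set: borelType M] (EFin \o (fun x => c * u x)).
  by move=> iu; have := integrableZl (mu := mu) measurableT c iu.
have eRe (u : C) : complex.Re (a * u) =
    complex.Re a * complex.Re u + (- complex.Im a) * complex.Im u.
  by case: (a) => ? ?; case: u => ? ? /=; rewrite mulNr.
have eIm (u : C) : complex.Im (a * u) =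
    complex.Re a * complex.Im u + complex.Im a * complex.Re u.
  by case: (a) => ? ?; case: u => ? ? /=.
have hR : \int[mu]_x complex.Re (a * f x + g x) =
   complex.Re a * (\int[mu]_x complex.Re (f x)) +
   (- complex.Im a) * (\int[mu]_x complex.Im (f x)) +
   \int[mu]_x complex.Re (g x).
  rewrite -!RintegralZl ?iRe ?iIm//.
  rewrite -intD ?intZ ?iRe ?iIm//.
  under eq_Rintegral do rewrite raddfD /=.
  rewrite [LHS](intD _ _ (iRe _ caf) (iRe _ cg)); congr (_ + _).
  by apply: eq_Rintegral => x _; rewrite eRe.
have hI : \int[mu]_x complex.Im (a * f x + g x) =
   complex.Re a * (\int[mu]_x complex.Im (f x)) +
   complex.Im a * (\int[mu]_x complex.Re (f x)) + \int[mu]_x complex.Im (g x).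
  rewrite -!RintegralZl ?iRe ?iIm//.
  rewrite -intD ?intZ ?iRe ?iIm//.
  under eq_Rintegral do rewrite raddfD /=.
  rewrite [LHS](intD _ _ (iIm _ caf) (iIm _ cg)); congr (_ + _).
  by apply: eq_Rintegral => x _; rewrite eIm.
rewrite /Cintegral hR hI mulNr.
by case: (a) => ? ?.
Qed.

Lemma inner_linearl (a : C) (f g h : M -> C) :
  continuous f -> continuous g -> continuous h ->
  inner mu (a *: f + g) h = a * inner mu f h + inner mu g h.
Proof.
move=> cf cg ch; rewrite /inner mulrCA -mulrDr.
rewrite -(Cintegral_linear _ (continuous_mul_conj cf ch)
  (continuous_mul_conj cg ch)).
by congr (_ * Cintegral _ _); apply/funext => x; rewrite mulrA -mulrDl.
Qed.

Lemma inner_linearr (a : C) (f g h : M -> C) :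
  continuous f -> continuous g -> continuous h ->
  inner mu h (a *: f + g) = a^* * inner mu h f + inner mu h g.
Proof.
move=> cf cg ch; rewrite /inner mulrCA -mulrDr.
rewrite -(Cintegral_linear _ (continuous_mul_conj ch cf)
  (continuous_mul_conj ch cg)).
congr (_ * Cintegral _ _); apply/funext => x.
by rewrite mulrCA -mulrDr -rmorphM -rmorphD.
Qed.

Lemma inner_suml (I : Type) (r : seq I) (c : I -> C) (f : I -> M -> C)
    (h : M -> C) :
  (forall i, continuous (f i)) -> continuous h ->
  inner mu (\sum_(i <- r) c i *: f i) h = \sum_(i <- r) c i * inner mu (f i) h.
Proof.
move=> cf ch; elim: r => [|i r IHr].
  (* Linearity at [1 *: 0 + 0] shows that [inner mu 0 h] equals twice itself, hence is 0. *)
  rewrite !big_nil; apply: (@addrI _ (inner mu 0 h)); rewrite addr0.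
  have c0 : continuous (0 : M -> C) by move=> x; exact: cvg_cst.
  by have := inner_linearl 1 c0 c0 ch; rewrite scaler0 addr0 mul1r => <-.
have clin := @continuous_lincomb C M I r c f cf.
by rewrite !big_cons (inner_linearl _ (cf i) clin ch) IHr.
Qed.

Lemma inner_sumr (I : Type) (r : seq I) (c : I -> C) (f : I -> M -> C)
    (h : M -> C) :
  (forall i, continuous (f i)) -> continuous h ->
  inner mu h (\sum_(i <- r) c i *: f i) =
  \sum_(i <- r) (c i)^* * inner mu h (f i).
Proof.
move=> cf ch; elim: r => [|i r IHr].
  rewrite !big_nil; apply: (@addrI _ (inner mu h 0)); rewrite addr0.
  have c0 : continuous (0 : M -> C) by move=> x; exact: cvg_cst.
  have := inner_linearr 1 c0 c0 ch.
  by rewrite scaler0 addr0 rmorph1 mul1r => <-.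
have clin := @continuous_lincomb C M I r c f cf.
by rewrite !big_cons (inner_linearr _ (cf i) clin ch) IHr.
Qed.

(** Change of variables: the left side is the integral against the pushforward of [mu] under [T],
    which agrees with [mu] on Borel sets. *)
Lemma Rintegral_measure_preserving (T : M -> M) (f : M -> R) :
  continuous T -> continuous f ->
  (forall A : set (borelType M), measurable A -> mu (T @^-1` A) = mu A) ->
  \int[mu]_x f (T x) = \int[mu]_x f x.
Proof.
move=> cT cf muT; rewrite /Rintegral; congr fine.
have mT := continuous_borel_measurable cT.
have mf : measurable_fun [set: borelType M] (EFin \o f).
  by apply/measurable_EFinP; exact: continuous_real_measurable.
have cfT : continuous (f \o T).
  by move=> x; apply: continuous_comp; [exact: cT|exact: cf].
have ifT := continuous_integrable cfT.
pose T' : borelType M -> borelType M := T.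
transitivity (\int[pushforward mu T']_x (f x)%:E)%E.
  by rewrite (integral_pushforward mT mf ifT measurableT).
apply: eq_measure_integral => A mA _; exact: muT.
Qed.

Lemma inner_fun_act (G : topologicalGroupType) (act : G -> M -> M)
    (f h : M -> C) (g : G) :
  continuous_action act -> invariant_measure mu act ->
  continuous f -> continuous h ->
  inner mu (fun_act act g f) (fun_act act g h) = inner mu f h.
Proof.
move=> [act1 actM cact] mu_inv cf ch; rewrite /inner; congr (_ * _).
have cT : continuous (act g^-1%g).
  move=> x; apply: (@continuous_comp _ _ _ (fun x => (g^-1%g, x))
    (fun z : G * M => act z.1 z.2)); last exact: cact.
  by apply: cvg_pair; [exact: cvg_cst|exact: cvg_id].
(* Invariance speaks of images under [act g]; these are the preimages under [act g^-1], the map that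
   occurs in [fun_act]. *)
have muT (A : set (borelType M)) :
    measurable A -> mu (act g^-1%g @^-1` A) = mu A.
  move=> mA; rewrite -(mu_inv g A mA); congr (mu _).
  apply/seteqP; split => [x Ax|_ [x Ax <-]] /=.
    by exists (act g^-1%g x) => //; rewrite -actM mulgV act1.
  by rewrite -actM mulVg act1.
have cu := continuous_mul_conj cf ch.
rewrite /Cintegral; congr Complex.
  apply: (@Rintegral_measure_preserving _
    (fun x => complex.Re (f x * (h x)^*)) cT _ muT) => x.
  apply: (@continuous_comp _ _ _ (fun x => f x * (h x)^*)
    (fun z : C => complex.Re z)); [exact: cu|exact: continuous_Re].
apply: (@Rintegral_measure_preserving _
  (fun x => complex.Im (f x * (h x)^*)) cT _ muT) => x.
apply: (@continuous_comp _ _ _ (fun x => f x * (h x)^*)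
    (fun z : C => complex.Im z)); [exact: cu|exact: continuous_Im].
Qed.

End Integration.

(** * Sesquilinear forms in a linearly independent family *)

Section SesquilinearForms.
Context {C : numClosedFieldType}.

(** Linear in [a] and conjugate linear in [b], like the generators of [tensor_square]. The matrix
    may be rectangular because a block can pair spaces of different dimensions. *)
Definition sesq (n1 n2 : nat) (A : 'M[C]_(n1, n2)) (a : 'I_n1 -> C)
    (b : 'I_n2 -> C) : C :=
  \sum_s \sum_t A s t * (a s * (b t)^*).

Lemma sesqE (n1 n2 : nat) (A : 'M[C]_(n1, n2)) (a : 'I_n1 -> C)
    (b : 'I_n2 -> C) :
  sesq A a b = ((\row_s a s) *m A *m (\col_t (b t)^*)) 0 0.
Proof.
rewrite /sesq exchange_big mxE; apply: eq_bigr => t _ /=.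
rewrite !mxE mulr_suml; apply: eq_bigr => s _.
by rewrite !mxE mulrA [A s t * _]mulrC.
Qed.

Lemma sesq_sum (n1 n2 : nat) (A : 'M[C]_(n1, n2)) (N1 N2 : nat)
    (alpha : 'I_N1 -> C) (beta : 'I_N2 -> C) (a : 'I_N1 -> 'I_n1 -> C)
    (b : 'I_N2 -> 'I_n2 -> C) :
  sesq A (fun s => \sum_i alpha i * a i s) (fun t => \sum_j beta j * b j t) =
  \sum_i \sum_j alpha i * sesq A (a i) (b j) * (beta j)^*.
Proof.
rewrite /sesq pair_big [RHS]pair_big /=.
under [RHS]eq_bigr do rewrite pair_big /= mulr_sumr mulr_suml.
rewrite [RHS]exchange_big /=; apply: eq_bigr => -[s t] _ /=.
rewrite rmorph_sum big_distrlr pair_big mulr_sumr /=.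
by apply: eq_bigr => -[i j] _ /=; rewrite rmorphM; ring.
Qed.

(** A linear substitution in both vectors is a congruence of the matrix, conjugated on the side
    where the form is conjugate linear. *)
Lemma sesq_mul (n1 n2 : nat) (A : 'M[C]_(n1, n2)) (P : 'M[C]_n1) (Q : 'M[C]_n2)
    (a : 'I_n1 -> C) (b : 'I_n2 -> C) :
  sesq A (fun s => \sum_t P s t * a t) (fun s => \sum_t Q s t * b t) =
  sesq (P^T *m A *m map_mx conjC Q) a b.
Proof.
rewrite !sesqE.
have -> : \row_s (\sum_t P s t * a t) = (\row_s a s) *m P^T.
  by apply/rowP => s; rewrite !mxE; apply: eq_bigr => t _; rewrite !mxE mulrC.
have -> : \col_s (\sum_t Q s t * b t)^* =
    map_mx conjC Q *m (\col_t (b t)^*).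
  apply/colP => s; rewrite !mxE rmorph_sum; apply: eq_bigr => t _.
  by rewrite !mxE rmorphM.
by rewrite !mulmxA.
Qed.

Lemma sesqB (n1 n2 : nat) (A B : 'M[C]_(n1, n2)) (a : 'I_n1 -> C)
    (b : 'I_n2 -> C) :
  sesq (A - B) a b = sesq A a b - sesq B a b.
Proof. by rewrite !sesqE mulmxBr mulmxBl !mxE. Qed.

(** * Linearly independent families of functions: coefficients and interpolation *)

Section Families.
Context {M : Type} {Q : finType} {n : Q -> nat}.
Variable e : forall q, 'I_(n q) -> M -> C.

Local Notation ev x := (fun s => e s x).

Local Notation P := {q : Q & 'I_(n q)}.

Definition linearly_independent : Prop :=
  forall c : (forall q, 'I_(n q) -> C),
    (forall x, \sum_q \sum_s c q s * e s x = 0) -> forall q s, c q s = 0.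

Hypothesis e_indep : linearly_independent.

(** The products of a member at [x] with a conjugated member at [y] are again independent:
    independence is applied once in [x] and once in [y]. *)
Lemma sesq_family_eq (A B : forall q r, 'M[C]_(n q, n r)) :
  (forall x y,
     \sum_q \sum_r sesq (A q r) (ev x) (ev y) =
     \sum_q \sum_r sesq (B q r) (ev x) (ev y)) ->
  forall q r, A q r = B q r.
Proof.
move=> AB q r; apply/matrixP => s t; apply/eqP; rewrite -subr_eq0.
pose D q' (s' : 'I_(n q')) r' (t' : 'I_(n r')) : C :=
  A q' r' s' t' - B q' r' s' t'.
(* For fixed [y] these sums are the coefficients of a vanishing combination of functions of [x]. *)
have D0 y : \sum_r' \sum_t' D q s r' t' * (e t' y)^* = 0.
  apply: (e_indep (c := fun q' s' =>
    \sum_r' \sum_t' D q' s' r' t' * (e t' y)^*)) => x.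
  transitivity (\sum_q \sum_r (sesq (A q r) (ev x) (ev y) -
      sesq (B q r) (ev x) (ev y))).
    apply: eq_bigr => q' _; under [RHS]eq_bigr do rewrite -sesqB.
    under [LHS]eq_bigr do rewrite mulr_suml.
    rewrite exchange_big; apply: eq_bigr => r' _ /=.
    rewrite /sesq; apply: eq_bigr => s' _; rewrite mulr_suml.
    by apply: eq_bigr => t' _; rewrite !mxE -mulrA [(e t' y)^* * _]mulrC.
  under eq_bigr do rewrite sumrB.
  by rewrite sumrB AB subrr.
(* Conjugation turns [D0] into a vanishing combination of the functions of [y] themselves. *)
rewrite -(conjC_eq0 (A q r s t - B q r s t)); apply/eqP.
apply: (e_indep (c := fun r' t' => (D q s r' t')^*)) => y.
transitivity ((\sum_r' \sum_t' D q s r' t' * (e t' y)^*)^*); last first.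
  by rewrite D0 rmorph0.
rewrite rmorph_sum; apply: eq_bigr => r' _.
rewrite rmorph_sum; apply: eq_bigr => t' _.
by rewrite rmorphM /= conjCK.
Qed.

(** By uniqueness of the coefficients, invariance of the function passes to every block
    separately. *)
Lemma invariant_sesq_family (A : forall q r, 'M[C]_(n q, n r)) (T : M -> M)
    (P : forall q, 'M[C]_(n q)) :
  (forall q (s : 'I_(n q)) x, e s (T x) = \sum_t P q s t * e t x) ->
  (forall x y,
     \sum_q \sum_r sesq (A q r) (ev (T x)) (ev (T y)) =
     \sum_q \sum_r sesq (A q r) (ev x) (ev y)) ->
  forall q r, (P q)^T *m A q r *m map_mx conjC (P r) = A q r.
Proof.
move=> eT AT.
apply: (sesq_family_eq
  (A := fun q r => (P q)^T *m A q r *m map_mx conjC (P r))).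
move=> x y; rewrite -AT; apply: eq_bigr => q _; apply: eq_bigr => r _.
rewrite -sesq_mul; congr sesq; apply/funext => s; exact/esym/eT.
Qed.

(** Evaluation points are added one at a time: as long as the rows do not span, some nonzero vector
    is annihilated by all of them, and independence supplies a point whose evaluation row does not
    annihilate it. *)
Lemma interpolation_rows (r : nat) :
  (r <= #|{: P}|)%N ->
  exists E : 'M[C]_(r, #|{: P}|), row_free E /\
    forall a, exists x, forall j,
      E a j = let p := enum_val j in e (tagged p) x.
Proof.
elim: r => [|r IHr] rn.
  by exists 0; split; [rewrite /row_free mxrank0|case].
have [E [Efree Ee]] := IHr (ltnW rn).
(* The rank [r] is smaller than the number of functions, so some column [c] of the cokernel is
   nonzero. *)
have cok : cokermx E != 0.
  rewrite -mxrank_eq0 mxrank_coker (eqP Efree) -lt0n subn_gt0; exact: rn.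
have [c [k ck] Ec0] : exists2 c : 'cV[C]_#|{: P}|,
    (exists k, c k 0 != 0) & E *m c = 0.
  case: (pselect (exists j k, cokermx E k j != 0)) => [[j [k cjk]]|c0].
    exists (col j (cokermx E)); first by exists k; rewrite mxE.
    by rewrite colE mulmxA mulmx_coker mul0mx.
  case/eqP: cok; apply/matrixP => k j; rewrite [RHS]mxE.
  by apply/eqP/negPn/negP => cjk; apply: c0; exists j, k.
(* Read as coefficients, [c] gives a combination that is nonzero at some point [x], the new
   point. *)
pose d q (s : 'I_(n q)) := c (enum_rank (Tagged (fun q => 'I_(n q)) s)) 0.
have [x xd] : exists x, \sum_q \sum_s d q s * e s x != 0.
  apply: contrapT => d0; case/eqP: ck.
  rewrite -(enum_valK k); case: (enum_val k) => q s.
  apply: (e_indep (c := d)) => x; apply/eqP/negPn/negP => dx.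
  by apply: d0; exists x.
pose v : 'rV[C]_#|{: P}| :=
  \row_j (let p := enum_val j in e (tagged p) x).
have vc : (v *m c) 0 0 != 0.
  move: xd; rewrite sig_big_dep /=.
  rewrite (reindex_onto enum_val enum_rank) /=; last first.
    by move=> p _; rewrite enum_rankK.
  rewrite !mxE; congr (_ != 0); apply: eq_big => [i|i _].
    by rewrite enum_valK eqxx.
  have := enum_valK i; rewrite mxE mulrC /d.
  by case: (enum_val i) => q s /= ->.
exists (col_mx v E : 'M[C]_(1 + r, _)); split; last first.
  move=> a; case: (@splitP 1 r a) => b ab.
    exists x => i; rewrite (_ : a = lshift r b); last exact/val_inj.
    by rewrite [LHS](col_mxEu v E b i) mxE.
  have [x' Ex'] := Ee b; exists x' => i.
  rewrite (_ : a = rshift 1 b); last exact/val_inj.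
  by rewrite [LHS](col_mxEd v E b i).
(* Multiplying a relation between the rows by [c] removes the rows of [E]; as [v *m c] is nonzero,
   the coefficient of [v] vanishes, and freeness of [E] settles the rest. *)
apply: inj_row_free => u uE0.
pose ul := lsubmx (u : 'M[C]_(1, 1 + r)).
pose ur := rsubmx (u : 'M[C]_(1, 1 + r)).
have uE : u = row_mx ul ur by rewrite hsubmxK.
have ulr0 : ul *m v + ur *m E = 0 by rewrite -mul_row_col -uE.
have ul0 : ul = 0.
  have := congr1 (fun w => (w *m c) 0 0) ulr0.
  rewrite mulmxDl -!mulmxA Ec0 mulmx0 addr0 mul0mx [LHS]mxE big_ord1.
  rewrite [RHS]mxE => /eqP; rewrite mulf_eq0 (negbTE vc) orbF => /eqP ul00.
  by apply/rowP => i; rewrite ord1 [RHS]mxE.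
move: ulr0; rewrite ul0 mul0mx add0r => /eqP.
by rewrite mulmx_free_eq0// => /eqP ur0; rewrite uE ul0 ur0 row_mx0.
Qed.

(** With as many points as functions the evaluation matrix is square and free, hence invertible, and
    [alpha] solves the linear system. *)
Lemma interpolation (u : forall q, 'I_(n q) -> C) :
  exists (N : nat) (x : 'I_N -> M) (alpha : 'I_N -> C),
    forall q s, \sum_a alpha a * e s (x a) = u q s.
Proof.
have [E [Efree Ex]] := interpolation_rows (leqnn _).
have {Ex} [x Ex] := choice Ex.
pose w : 'rV[C]_#|{: P}| := \row_j (let p := enum_val j in u _ (tagged p)).
exists #|{: P}|, x, (fun a => (w *m invmx E) 0 a) => q s.
transitivity (w 0 (enum_rank (Tagged (fun q => 'I_(n q)) s))); last first.
  by rewrite mxE enum_rankK.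
have Eunit : E \in unitmx by rewrite -row_free_unit.
rewrite -[in RHS](mulmxKV Eunit w) [RHS]mxE; apply: eq_bigr => a _.
by rewrite Ex enum_rankK.
Qed.

(** Positive definiteness tests the form at combinations of evaluation vectors; by interpolation
    these are all vectors. *)
Lemma sesq_family_psd (A : forall q r, 'M[C]_(n q, n r)) (F : M -> M -> C) :
  (forall x y, F x y = \sum_q \sum_r sesq (A q r) (ev x) (ev y)) ->
  (forall (N : nat) (x : 'I_N -> M) (alpha : 'I_N -> C),
     0 <= \sum_(i < N) \sum_(j < N) alpha i * F (x i) (x j) * (alpha j)^*) <->
  (forall u : (forall q, 'I_(n q) -> C),
     0 <= \sum_q \sum_r sesq (A q r) (u q) (u r)).
Proof.
move=> FE.
have sumE (N : nat) (x : 'I_N -> M) (alpha : 'I_N -> C)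
    (u := fun q (s : 'I_(n q)) => \sum_a alpha a * e s (x a)) :
    \sum_(i < N) \sum_(j < N) alpha i * F (x i) (x j) * (alpha j)^* =
    \sum_q \sum_r sesq (A q r) (@u q) (@u r).
  under [RHS]eq_bigr do under eq_bigr do rewrite sesq_sum.
  rewrite pair_big [RHS]pair_big /=.
  under [RHS]eq_bigr do rewrite pair_big /=.
  rewrite [RHS]exchange_big /=; apply: eq_bigr => -[i j] _ /=.
  by rewrite FE pair_big /= mulr_sumr mulr_suml.
split=> [Fpos u|Apos N x alpha]; last by rewrite sumE.
have [N [x [alpha ualpha]]] := interpolation u.
have := Fpos N x alpha; rewrite sumE.
congr (0 <= _); apply: eq_bigr => q _; apply: eq_bigr => r _.
by congr sesq; apply/funext => s; rewrite ualpha.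
Qed.

End Families.
End SesquilinearForms.

(** * Schur's lemma *)

Section Schur.
Context {G : Type} {F : fieldType}.

(** Irreducibility in matrix form. Subspaces are row spaces of square matrices, and [pi g] acts on
    rows from the right. *)
Definition no_stable_rows (n : nat) (pi : G -> 'M[F]_n) : Prop :=
  forall U : 'M[F]_n, (forall g, (U *m pi g <= U)%MS) -> U = 0 \/ row_full U.

(** The kernel of [X] is stable under [pi1] and its row space under [pi2], so each is zero or
    everything. *)
Lemma schur_row_bijective (n1 n2 : nat) (pi1 : G -> 'M[F]_n1)
    (pi2 : G -> 'M[F]_n2) (X : 'M[F]_(n1, n2)) :
  no_stable_rows pi1 -> no_stable_rows pi2 ->
  (forall g, pi1 g *m X = X *m pi2 g) ->
  X = 0 \/ row_free X /\ row_full X.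
Proof.
move=> irr1 irr2 piX.
have stable_ker g : (kermx X *m pi1 g <= kermx X)%MS.
  by apply/sub_kermxP; rewrite -mulmxA piX mulmxA mulmx_ker mul0mx.
(* [<<X>>] is a square matrix with the row space of the rectangular [X], as [no_stable_rows]
   requires. *)
have stable_im g : (<<X>>%MS *m pi2 g <= <<X>>%MS)%MS.
  by rewrite genmxE (eqmxMr _ (genmxE X)) -piX submxMl.
case: (irr2 _ stable_im) => [X0|Xfull].
  by left; apply/eqP; rewrite -submx0 -X0 genmxE.
case: (irr1 _ stable_ker) => [kX|kfull].
  right; split; first by rewrite -kermx_eq0 kX.
  by move: Xfull; rewrite /row_full genmxE.
left; have /sub_kermxP : (1%:M <= kermx X)%MS by rewrite sub1mx.
by rewrite mul1mx.
Qed.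

End Schur.

(** For an eigenvalue [a] of [X] the matrix [X - a%:M] still intertwines but is not injective, hence
    is zero. *)
Lemma schur_scalar (G : Type) (C : numClosedFieldType) (n : nat)
    (pi : G -> 'M[C]_n) (X : 'M[C]_n) :
  no_stable_rows pi -> (forall g, pi g *m X = X *m pi g) ->
  exists a, X = a%:M.
Proof.
(* In dimension 0 there is no eigenvalue, but the empty matrix is scalar. *)
case: (posnP n) => [n0 _ _|n_gt0 irr piX].
  by exists 0; apply/matrixP => i; have := ltn_ord i; rewrite {2}n0.
have [a Xa] := eigenvalue_closed X n_gt0; exists a.
have piXa g : pi g *m (X - a%:M) = (X - a%:M) *m pi g.
  by rewrite mulmxBr mulmxBl piX scalar_mxC.
have [/eqP|[Xfree _]] := schur_row_bijective irr irr piXa.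
  by rewrite subr_eq0 => /eqP.
by move: Xa; rewrite /eigenvalue kermx_eq0 Xfree.
Qed.

(** [lin_span] allows combinations of any length with repetitions; coefficients belonging to the
    same chosen index are added up. *)
Lemma lin_span_range (K : fieldType) (L : lmodType K) (n : nat)
    (b : 'I_n -> L) (v : L) :
  lin_span (range b) v <-> exists c : 'I_n -> K, v = \sum_s c s *: b s.
Proof.
split=> [[N [c [w [wb ->]]]]|[c ->]]; last by exists n, c, b.
have wb' i : exists s, b s = w i by have [s _ bs] := wb i; exists s.
have [f fP] := choice wb'.
exists (fun s => \sum_(i | f i == s) c i).
rewrite (partition_big f xpredT) //=; apply: eq_bigr => s _.
rewrite scaler_suml; apply: eq_bigr => i /eqP <-.
by rewrite fP.
Qed.

Section IntertwiningRepresentations.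
Context {R : realType} {G : topologicalGroupType}.
Local Notation C := (Cplx R).

(** [Y] acts on rows while representations act on columns, so the isomorphism is multiplication by
    [Y^T]. *)
Lemma isomorphic_of_intertwiner (n1 n2 : nat) (rho1 : G -> 'M[C]_n1)
    (rho2 : G -> 'M[C]_n2) (Y : 'M[C]_(n1, n2)) :
  row_free Y -> row_full Y ->
  (forall g, (rho1 g)^T *m Y = Y *m (rho2 g)^T) ->
  isomorphic_representations rho1 rho2.
Proof.
move=> /row_freeP[B YB] /row_fullP[D DY] intY.
exists (mulmx Y^T); split; last first.
  move=> g v _; rewrite /mx_act /= !mulmxA; congr (_ *m v).
  by apply: trmx_inj; rewrite !trmx_mul trmxK.
split=> // [v w _ _ vw|w _].
  have := congr1 (mulmx B^T) vw.
  by rewrite !mulmxA -trmx_mul YB trmx1 !mul1mx.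
by exists (D^T *m w) => //=; rewrite mulmxA -trmx_mul DY trmx1 mul1mx.
Qed.

End IntertwiningRepresentations.

(** * Matrix representation in an orthonormal basis *)

Section OrthonormalBasis.
Context {R : realType} {G : topologicalGroupType} {M : ptopologicalType}.
Hypothesis compact_M : compact [set: M].
Variable act : G -> M -> M.
Variable mu : {finite_measure set (borelType M) -> \bar R}.
Hypothesis act_continuous : continuous_action act.
Hypothesis mu_invariant : invariant_measure mu act.
Local Notation C := (Cplx R).

Lemma fun_act_lincomb (I : Type) (r : seq I) (c : I -> C) (f : I -> M -> C) g :
  fun_act act g (\sum_(i <- r) c i *: f i) =
  \sum_(i <- r) c i *: fun_act act g (f i).
Proof.
apply/funext => x; rewrite /fun_act !fct_sumE.
by apply: eq_bigr => i _.
Qed.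

(** For an orthonormal basis of a stable space, row [s] holds the coordinates of the translate of
    [b s]: the transpose of the usual matrix on columns. *)
Definition repmx (n : nat) (b : 'I_n -> M -> C) (g : G) : 'M[C]_n :=
  \matrix_(s, t) inner mu (fun_act act g (b s)) (b t).

Variables (n : nat) (b : 'I_n -> M -> C) (W : set (M -> C)).
Hypothesis W_subspace : G_subspace_of_continuous act W.
Hypothesis b_onb : orthonormal_basis mu b W.

Lemma onb_in s : W (b s).
Proof.
case: b_onb => _ ->; apply/lin_span_range; exists (fun t => (t == s)%:R).
rewrite (bigD1 s) //= eqxx scale1r big1 ?addr0 // => t /negbTE ->.
by rewrite scale0r.
Qed.

Lemma onb_continuous s : continuous (b s).
Proof. by case: W_subspace => Wc _; apply: Wc; exact: onb_in. Qed.

Lemma inner_lincomb_onb (c : 'I_n -> C) t :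
  inner mu (\sum_s c s *: b s) (b t) = c t.
Proof.
rewrite (inner_suml compact_M mu) => [||]; try exact: onb_continuous.
case: b_onb => orth _; rewrite (bigD1 t) //= orth eqxx mulr1 big1 ?addr0 //.
by move=> s /negbTE st; rewrite orth st mulr0.
Qed.

Lemma onb_expand f : W f -> f = \sum_s inner mu f (b s) *: b s.
Proof.
case: (b_onb) => _ WE; rewrite {1}WE => /lin_span_range[c ->].
by apply: eq_bigr => s _; rewrite inner_lincomb_onb.
Qed.

Lemma fun_act_onb g s : fun_act act g (b s) = \sum_t repmx b g s t *: b t.
Proof.
have Wgb : W (fun_act act g (b s)).
  by case: W_subspace => _ [_]; apply; exact: onb_in.
by rewrite {1}(onb_expand Wgb); apply: eq_bigr => t _; rewrite mxE.
Qed.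

(** Translation preserves the inner product, so the translates of the basis are again
    orthonormal. *)
Lemma repmx_unitary g : repmx b g *m map_mx conjC (repmx b g)^T = 1%:M.
Proof.
apply/matrixP => s t; case: (b_onb) => orth _; rewrite [RHS]mxE -orth.
rewrite -(inner_fun_act compact_M g act_continuous mu_invariant
  (@onb_continuous s) (@onb_continuous t)).
rewrite [in RHS](fun_act_onb g t).
rewrite (inner_sumr compact_M mu); [|exact: onb_continuous|]; last first.
  by case: W_subspace => Wc [_ Wact]; apply: Wc; apply: Wact; exact: onb_in.
by rewrite mxE; apply: eq_bigr => u _; rewrite !mxE mulrC.
Qed.

(** The combinations of [b] with coefficient row in a stable row space [U] form a [G]-subspace of
    [W], which is zero or [W]; uniqueness of coordinates carries this back to [U]. *)
Lemma irreducible_no_stable_rows :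
  G_irreducible (fun_act act) W -> no_stable_rows (repmx b).
Proof.
move=> [[Wsub Wact] _ Wirr] U Ustable.
pose lc (v : 'rV[C]_n) := \sum_s v 0 s *: b s.
have lcE v t : inner mu (lc v) (b t) = v 0 t by exact: inner_lincomb_onb.
have lc00 : lc 0 = 0 by rewrite /lc big1// => s _; rewrite mxE scale0r.
pose W' := [set f | exists2 v : 'rV[C]_n, (v <= U)%MS & f = lc v].
have W'sub : G_subspace (fun_act act) W'.
  split; first split.
  - rewrite in_setE; by exists 0; rewrite ?sub0mx ?lc00.
  - move=> a f h /[!in_setE] -[v vU ->] [w wU ->].
    exists (a *: v + w); first by rewrite addmx_sub ?scalemx_sub.
    rewrite /lc scaler_sumr -big_split; apply: eq_bigr => s _ /=.
    by rewrite !mxE scalerA scalerDl.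
  - move=> g f [v vU ->]; exists (v *m repmx b g).
      exact: submx_trans (submxMr _ vU) (Ustable g).
    rewrite /lc fun_act_lincomb.
    under eq_bigr do rewrite fun_act_onb scaler_sumr.
    rewrite exchange_big; apply: eq_bigr => t _ /=.
    rewrite mxE scaler_suml; apply: eq_bigr => s _.
    by rewrite scalerA.
have W'W : W' `<=` W.
  move=> _ [v _ ->]; case: (b_onb) => _ ->.
  by apply/lin_span_range; exists (v 0).
case: (Wirr _ W'sub W'W) => W'E.
  left; apply/row_matrixP => i; rewrite row0; apply/rowP => t; rewrite [RHS]mxE.
  have : W' (lc (row i U)) by exists (row i U); rewrite ?row_sub.
  rewrite W'E => lc0; rewrite -[LHS]lcE lc0 -lc00 lcE mxE//.
right; rewrite -sub1mx; apply/row_subP => i.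
have : W' (b i) by rewrite W'E; exact: onb_in.
case=> v vU biv; suff -> : row i 1%:M = v by [].
apply/rowP => t; rewrite -[RHS]lcE -biv !mxE.
by case: b_onb => ->; rewrite eq_sym.
Qed.

(** [P] is the matrix of the isomorphism in the standard basis and [b], with coordinates in rows;
    hence the transpose of [rho g]. *)
Lemma representation_coordinates (rho : G -> 'M[C]_n) :
  G_isomorphic (mx_act rho) (fun_act act) [set: 'cV[C]_n] W ->
  exists2 P : 'M[C]_n, P \in unitmx &
    forall g, (rho g)^T *m P = P *m repmx b g.
Proof.
move=> [phi [[phiW phi_inj _] phi_act]].
pose P := \matrix_(u, s) inner mu (phi (delta_mx u 0)) (b s).
have phi_delta u : phi (delta_mx u 0) = \sum_s P u s *: b s.
  rewrite {1}(onb_expand (phiW _ I)).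
  by apply: eq_bigr => s _; rewrite mxE.
have phiE v : phi v = \sum_s (v^T *m P) 0 s *: b s.
  rewrite {1}(matrix_sum_delta v) linear_sum /=.
  under eq_bigr do rewrite big_ord1 linearZ /= phi_delta scaler_sumr.
  rewrite exchange_big; apply: eq_bigr => s _ /=.
  rewrite mxE scaler_suml; apply: eq_bigr => u _.
  by rewrite scalerA [v^T _ _]mxE.
exists P.
  (* A row annihilated by [P] is the transpose of a vector annihilated by the injective [phi]. *)
  rewrite -row_free_unit; apply: inj_row_free => v vP.
  apply: trmx_inj; rewrite trmx0; apply: phi_inj; rewrite ?in_setE//.
  rewrite linear0 phiE trmxK vP big1// => s _.
  by rewrite mxE scale0r.
move=> g; apply/matrixP => u t.
suff PE : \sum_s ((rho g)^T *m P) u s *: b s =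
    \sum_s (P *m repmx b g) u s *: b s.
  rewrite -[LHS](inner_lincomb_onb (((rho g)^T *m P) u)) PE.
  by rewrite inner_lincomb_onb.
(* Both sides expand the image under [phi] of [rho g] applied to the standard vector with index
   [u]. *)
transitivity (phi (mx_act rho g (delta_mx u 0))).
  rewrite phiE; apply: eq_bigr => s _; congr (_ *: _).
  by rewrite /mx_act -colE tr_col -row_mul [RHS]mxE.
rewrite phi_act// phi_delta fun_act_lincomb.
under eq_bigr do rewrite fun_act_onb scaler_sumr.
rewrite exchange_big; apply: eq_bigr => s _ /=.
rewrite mxE scaler_suml; apply: eq_bigr => w _.
by rewrite scalerA.
Qed.

End OrthonormalBasis.

(** * Vanishing intertwiners, scalar blocks and Hermitian forms *)

Lemma intertwiner_eq0 (R : realType) (G : topologicalGroupType) (n1 n2 : nat)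
    (rho1 pi1 : G -> 'M[Cplx R]_n1) (rho2 pi2 : G -> 'M[Cplx R]_n2)
    (P1 : 'M[Cplx R]_n1) (P2 : 'M[Cplx R]_n2) (X : 'M[Cplx R]_(n1, n2)) :
  P1 \in unitmx -> P2 \in unitmx ->
  (forall g, (rho1 g)^T *m P1 = P1 *m pi1 g) ->
  (forall g, (rho2 g)^T *m P2 = P2 *m pi2 g) ->
  no_stable_rows pi1 -> no_stable_rows pi2 ->
  ~ isomorphic_representations rho1 rho2 ->
  (forall g, pi1 g *m X = X *m pi2 g) -> X = 0.
Proof.
move=> P1u P2u rhoP1 rhoP2 irr1 irr2 noniso intX.
have [//|[Xfree Xfull]] := schur_row_bijective irr1 irr2 intX.
exfalso; apply: noniso.
(* By Schur's lemma a nonzero [X] is bijective; transported by [P1] and [P2] it becomes an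
   isomorphism from [rho1] to [rho2]. *)
have rankY : \rank (P1 *m X *m invmx P2) = \rank X.
  rewrite mxrankMfree ?row_free_unit ?unitmx_inv//.
  by rewrite (eqmxMfull _ _) ?row_full_unit.
apply: (@isomorphic_of_intertwiner _ _ _ _ _ _ (P1 *m X *m invmx P2)).
- by rewrite /row_free rankY.
- by rewrite /row_full rankY.
move=> g; rewrite !mulmxA rhoP1 -[P1 *m _ *m X]mulmxA intX.
rewrite -!mulmxA; do 2 congr (_ *m _).
by rewrite -[RHS](mulmxK P2u) -[_ *m _ *m P2]mulmxA rhoP2 mulKmx.
Qed.

Lemma sesq_scalar (C : numClosedFieldType) (n : nat) (a : C)
    (u v : 'I_n -> C) : sesq a%:M u v = a * \sum_s u s * (v s)^*.
Proof.
rewrite mulr_sumr; apply: eq_bigr => s _.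
rewrite (bigD1 s) //= mxE eqxx big1 ?addr0 // => t /negbTE ts.
by rewrite mxE eq_sym ts mul0r.
Qed.

Lemma sesq_conj (C : numClosedFieldType) (n1 n2 : nat) (A : 'M[C]_(n1, n2))
    (u : 'I_n1 -> C) (v : 'I_n2 -> C) :
  (sesq A u v)^* = sesq (map_mx conjC A^T) v u.
Proof.
rewrite /sesq rmorph_sum [RHS]exchange_big; apply: eq_bigr => s _ /=.
rewrite rmorph_sum; apply: eq_bigr => t _.
by rewrite !mxE !rmorphM /= conjCK [(v t) * _]mulrC.
Qed.

(** The two conjugations cancel, and [A] appears in block form: the pair [(i, j)] carries the scalar
    block with value [A i j]. *)
Lemma mx_inner_zonal (R : realType) (M : ptopologicalType) (K : choiceType)
    (d m : K -> nat) (e : forall k, 'I_(m k) -> 'I_(d k) -> M -> Cplx R)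
    (k : K) (A : 'M[Cplx R]_(m k)) (x y : M) :
  mx_inner A (map_mx conjC (zonal_mx e k x y)) =
  \sum_i \sum_j sesq (A i j)%:M (fun s => e k i s x) (fun s => e k j s y).
Proof.
rewrite /mx_inner /mxtrace exchange_big; apply: eq_bigr => j _ /=.
rewrite mxE; apply: eq_bigr => i _.
by rewrite sesq_scalar !mxE /= conjCK mulrC.
Qed.

(** The definition conjugates the left vector and [sesq] the right one; replacing [v] by its
    conjugate passes between the two. *)
Lemma hermitian_psdP (R : realType) (n : nat) (A : 'M[Cplx R]_n) :
  hermitian_psd A <->
  (forall i j, A i j = (A j i)^*) /\
  (forall v : 'I_n -> Cplx R, 0 <= \sum_i \sum_j A i j * (v i * (v j)^*)).
Proof.
have qE (v : 'cV[Cplx R]_n) : (map_mx conjC v^T *m A *m v) 0 0 =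
    \sum_i \sum_j A i j * ((v i 0)^* * (v j 0)^* ^*).
  rewrite exchange_big mxE; apply: eq_bigr => j _ /=.
  rewrite mxE mulr_suml; apply: eq_bigr => i _.
  by rewrite !mxE conjCK; ring.
split=> [[/is_hermitianmxP herm psd]|[herm psd]]; split.
- by move=> i j; rewrite {1}herm expr0 scale1r !mxE.
- move=> v; have := psd (\col_i (v i)^*); rewrite qE.
  congr (0 <= _); apply: eq_bigr => i _; apply: eq_bigr => j _.
  by rewrite !mxE !conjCK.
- by apply/is_hermitianmxP/matrixP => i j; rewrite expr0 scale1r !mxE.
- by move=> v; rewrite qE; exact: psd (fun i => (v i 0)^*).
Qed.

(** Conjugating the invariance relation turns [P^T] into the adjoint of [P], which [P] cancels from
    the left. Hence the intertwiner is the conjugate of [A]. *)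
Lemma sesq_invariant_intertwines (C : numClosedFieldType) (n1 n2 : nat)
    (A : 'M[C]_(n1, n2)) (P : 'M[C]_n1) (Q : 'M[C]_n2) :
  P *m map_mx conjC P^T = 1%:M -> P^T *m A *m map_mx conjC Q = A ->
  P *m map_mx conjC A = map_mx conjC A *m Q.
Proof.
move=> Punit PAQ; rewrite -{1}PAQ !map_mxM !mulmxA Punit mul1mx.
by congr (_ *m _); apply/matrixP => i j; rewrite !mxE; exact: conjCK.
Qed.

(** * Zonal matrices *)

Section ZonalDecomposition.
Context {R : realType} {G : topologicalGroupType} {M : ptopologicalType}.
Local Notation C := (Cplx R).
Hypothesis compact_M : compact [set: M].
Variable act : G -> M -> M.
Hypothesis act_continuous : continuous_action act.
Variable mu : {finite_measure set (borelType M) -> \bar R}.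
Hypothesis mu_invariant : invariant_measure mu act.
Variable V : set (M -> C).
Hypothesis V_subspace : G_subspace_of_continuous act V.
Variables (K : choiceType) (d : K -> nat) (rho : forall k, G -> 'M[C]_(d k)).
Hypothesis rho_noniso :
  forall k l, k != l -> ~ isomorphic_representations (rho k) (rho l).
Variables (IV : {fset K}) (m : K -> nat).
Variable H : forall k, 'I_(m k) -> set (M -> C).
Hypothesis V_decomposition : orthogonal_decomposition mu act V rho IV H.
Variable e : forall k, 'I_(m k) -> 'I_(d k) -> M -> C.
Hypothesis e_bases : adapted_bases mu act IV H e.

(** [Q] is the finite type of pairs [(k, i)] indexing the summands; [k] ranges over the subtype
    [IV], where the hypotheses on [m], [H] and [e] apply. *)
Local Notation Q := {k : IV & 'I_(m (val k))}.
Local Notation n := (fun q : Q => d (val (tag q))).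
Local Notation E := (fun q : Q => @e (val (tag q)) (tagged q)).
Local Notation tg k i := (@Tagged IV k (fun l : IV => 'I_(m (val l))) i).

Lemma H_subspace (q : Q) : G_subspace_of_continuous act (H (tagged q)).
Proof.
by case: V_decomposition => _ _ /(_ _ (tagged q) (valP (tag q)))[].
Qed.

Lemma E_onb (q : Q) : orthonormal_basis mu (E q) (H (tagged q)).
Proof. by case: e_bases => /(_ _ (tagged q) (valP (tag q))). Qed.

Lemma E_continuous (q : Q) s : continuous (E q s).
Proof. exact: onb_continuous (H_subspace q) (E_onb q) s. Qed.

Lemma E_orthonormal (p p' : {q : Q & 'I_(n q)}) :
  inner mu (E (tag p) (tagged p)) (E (tag p') (tagged p')) = (p == p')%:R.
Proof.
case: p p' => q s [r t] /=; have [qr|qr] := eqVneq q r.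
  case: r / qr in t *; have [-> _] := E_onb q.
  by rewrite -tag_eqE /tag_eq eqxx tagged_asE.
have -> : (existT (fun q : Q => 'I_(n q)) q s == existT _ r t) = false.
  by apply: contra_neqF qr => /eqP/(congr1 (@tag _ _)).
have qs := onb_in (E_onb q) s; have rt := onb_in (E_onb r) t.
case: V_decomposition => _ _ _ orth _.
apply: (orth _ _ _ _ (valP (tag q)) (valP (tag r)) _ _ _ qs rt).
(* Orthogonality is assumed for distinct pairs tagged over [K]; equal indices in [K] are equal in
   the subtype [IV]. *)
apply: contraNneq qr; case: q r {s t qs rt} => [k i] [l j] /= kl.
have klv : k = l by apply/val_inj; exact: (congr1 (@tag _ _) kl).
case: l / klv in j kl *.
by move/eqP: kl; rewrite eq_Tagged => /eqP /= ->.
Qed.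

(** Pairing a vanishing combination with one member isolates its coefficient. *)
Lemma E_independent : linearly_independent E.
Proof.
move=> c c0 r t.
pose f (p : {q : Q & 'I_(n q)}) := c (tag p) (tagged p).
pose g (p : {q : Q & 'I_(n q)}) := E (tag p) (tagged p).
have S0 : \sum_p f p *: g p = 0.
  apply/funext => x; rewrite fct_sumE -[RHS](c0 x).
  by rewrite [RHS]sig_big_dep.
have gc p : continuous (g p) by exact: E_continuous.
have := inner_suml compact_M mu (index_enum _) f gc (@E_continuous r t).
rewrite S0 (bigD1 (Tagged (fun q : Q => 'I_(n q)) t)) //=.
rewrite (E_orthonormal (Tagged _ t) (Tagged _ t)) eqxx mulr1 big1.
  rewrite addr0 /f /= => <-.
  (* The empty combination shows that the inner product with 0 vanishes. *)
  have := inner_suml compact_M mu [::] f gc (@E_continuous r t).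
  by rewrite !big_nil.
by move=> p /negbTE pt; rewrite (E_orthonormal p (Tagged _ t)) pt mulr0.
Qed.

Lemma E_spans (f : M -> C) : V f ->
  exists c : forall q : Q, 'I_(n q) -> C,
    forall x, f x = \sum_q \sum_s c q s * E q s x.
Proof.
case: V_decomposition => _ _ _ _ -> [h hH <-].
exists (fun q s => inner mu (h _ (tagged q)) (E q s)) => x.
rewrite big_seq_fsetE /= fct_sumE.
under [LHS]eq_bigr do rewrite fct_sumE.
rewrite sig_big_dep; apply: eq_bigr => q _ /=.
have hq := hH _ (tagged q) (valP (tag q)).
by rewrite {1}(onb_expand compact_M (H_subspace q) (E_onb q) hq) fct_sumE.
Qed.

Lemma tensor_square_sesq (F : M * M -> C) : tensor_square V F ->
  exists A : forall q r : Q, 'M[C]_(n q, n r), forall x y,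
    F (x, y) = \sum_q \sum_r sesq (A q r) (fun s => E q s x) (fun s => E r s y).
Proof.
move=> [N [c [w [wV ->]]]].
have wE a : exists A : forall q r : Q, 'M[C]_(n q, n r), forall x y,
    w a (x, y) =
    \sum_q \sum_r sesq (A q r) (fun s => E q s x) (fun s => E r s y).
  have [f1 [f2 [/E_spans[c1 f1E] /E_spans[c2 f2E] ->]]] := wV a.
  (* A product of two functions of [V] has blocks of rank at most one. *)
  exists (fun q r => \matrix_(s, t) (c1 q s * (c2 r t)^*)) => x y /=.
  rewrite f1E f2E rmorph_sum big_distrlr /=; apply: eq_bigr => q _.
  apply: eq_bigr => r _; rewrite rmorph_sum big_distrlr /=.
  apply: eq_bigr => s _; apply: eq_bigr => t _.
  by rewrite mxE rmorphM /=; ring.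
have [A wA] := choice wE.
exists (fun q r => \sum_a c a *: A a q r) => x y.
rewrite fct_sumE.
transitivity (\sum_a c a * \sum_q \sum_r
    sesq (A a q r) (fun s => E q s x) (fun s => E r s y)).
  by apply: eq_bigr => a _; rewrite -wA.
under [LHS]eq_bigr do rewrite pair_big mulr_sumr.
rewrite exchange_big [RHS]pair_big /=; apply: eq_bigr => -[q r] _ /=.
rewrite /sesq; under [LHS]eq_bigr do rewrite pair_big mulr_sumr.
rewrite exchange_big [RHS]pair_big /=; apply: eq_bigr => -[s t] _ /=.
by rewrite summxE mulr_suml; apply: eq_bigr => a _; rewrite mxE -!mulrA.
Qed.

Lemma invariant_coefficients (F : M * M -> C)
    (A : forall q r : Q, 'M[C]_(n q, n r)) :
  (forall x y, F (x, y) =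
    \sum_q \sum_r sesq (A q r) (fun s => E q s x) (fun s => E r s y)) ->
  G_invariant act F ->
  (forall q r, tag q != tag r -> A q r = 0) /\
  (forall (k : IV) (i j : 'I_(m (val k))),
     exists a, A (tg k i) (tg k j) = a%:M).
Proof.
move=> FE F_inv.
pose pi (q : Q) := repmx act mu (E q).
(* The translation is by [g^-1], because [fun_act act g] evaluates at [act g^-1 x]. *)
have A_inv g q r : (pi q g)^T *m A q r *m map_mx conjC (pi r g) = A q r.
  apply: (invariant_sesq_family E_independent (T := act g^-1%g)
    (P := fun q => pi q g)) => [q' s x|x y]; last by rewrite -!FE F_inv.
  have /(congr1 (fun f => f x)) :=
    fun_act_onb compact_M (H_subspace q') (E_onb q') g s.
  by rewrite fct_sumE.
have A_int q r g :
    pi q g *m map_mx conjC (A q r) = map_mx conjC (A q r) *m pi r g.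
  apply: sesq_invariant_intertwines (A_inv g q r).
  exact: (repmx_unitary compact_M act_continuous mu_invariant
    (H_subspace q) (E_onb q) g).
have irr q : no_stable_rows (pi q).
  apply: (irreducible_no_stable_rows compact_M (H_subspace q) (E_onb q)).
  by case: V_decomposition => _ _ /(_ _ (tagged q) (valP (tag q)))[].
have conj_conjA q r :
    map_mx conjC (map_mx conjC (A q r)) = A q r.
  by apply/matrixP => s t; rewrite !mxE; exact: conjCK.
split=> [q r qr|k i j].
  have iso q' : exists2 P, P \in unitmx &
      forall g, (rho (val (tag q')) g)^T *m P = P *m pi q' g.
    apply: (representation_coordinates compact_M (H_subspace q') (E_onb q')).
    by case: V_decomposition => _ _ /(_ _ (tagged q') (valP (tag q')))[].
  have [[P1 P1u rhoP1] [P2 P2u rhoP2]] := (iso q, iso r).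
  have noniso :
      ~ isomorphic_representations (rho (val (tag q))) (rho (val (tag r))).
    by apply: rho_noniso; rewrite (inj_eq val_inj).
  have Aqr0 := intertwiner_eq0 P1u P2u rhoP1 rhoP2 (irr q) (irr r) noniso
    (A_int q r).
  by rewrite -conj_conjA Aqr0 map_mx0.
(* Adaptedness of the bases makes the two matrix representations equal, so the block commutes with a
   single irreducible one. *)
have pi_ij g : pi (tg k j) g = pi (tg k i) g.
  apply/matrixP => s t; rewrite !mxE /=.
  by case: e_bases => _; apply; exact: valP.
have [||a Aij] := @schur_scalar _ _ _ (pi (tg k i))
  (map_mx conjC (A (tg k i) (tg k j))).
- exact: irr.
- by move=> g; rewrite (A_int (tg k i) (tg k j)) pi_ij.
by exists a^*; rewrite -conj_conjA Aij map_scalar_mx.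
Qed.

(** * Existence of the matrices [F_k] *)

Lemma sum_tagged (f : Q -> C) :
  \sum_q f q = \sum_(k : IV) \sum_(i < m (val k)) f (tg k i).
Proof. by rewrite sig_big_dep; apply: eq_bigr => -[k i]. Qed.

(** An irreducible space is nonzero. This provides an entry at which the value of a scalar block can
    be read off. *)
Lemma dimension_gt0 (k : IV) : (0 < d (val k))%N.
Proof.
case: V_decomposition => _ m_gt0 H_rep _ _.
pose i0 := Ordinal (m_gt0 _ (valP k)).
case: (H_rep _ i0 (valP k)) => _ [[Hsub _] Hneq0 _] _.
rewrite lt0n; apply/eqP => d0; apply: Hneq0.
case: (e_bases.1 _ i0 (valP k)) => _ HE; rewrite HE.
have sum0 (c : 'I_(d (val k)) -> C) : \sum_s c s *: e i0 s = 0.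
  by apply: big1 => s; have := ltn_ord s; rewrite {2}d0.
apply/seteqP; split=> f /=.
  by move/lin_span_range => [c ->]; rewrite sum0.
by move=> ->; apply/lin_span_range; exists (fun=> 0); rewrite sum0.
Qed.

Lemma zonal_expansion (Fk : forall k, 'M[C]_(m k)) (x y : M) :
  \sum_(k <- IV) mx_inner (Fk k) (map_mx conjC (zonal_mx e k x y)) =
  \sum_(k : IV) \sum_(i < m (val k)) \sum_(j < m (val k))
    sesq (Fk (val k) i j)%:M
      (fun s => E (tg k i) s x) (fun s => E (tg k j) s y).
Proof.
rewrite big_seq_fsetE /=; apply: eq_bigr => k _.
by rewrite mx_inner_zonal.
Qed.

Lemma zonal_coefficients (F : M * M -> C) :
  tensor_square V F -> G_invariant act F -> positive_definite F ->
  exists Fk : forall k, 'M[C]_(m k),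
    (forall k, k \in IV -> hermitian_psd (Fk k)) /\
    (forall x y, F (x, y) =
      \sum_(k <- IV) mx_inner (Fk k) (map_mx conjC (zonal_mx e k x y))).
Proof.
move=> /tensor_square_sesq[A FE] F_inv [_ F_herm F_pos].
have [A_neq0 A_scalar] := invariant_coefficients FE F_inv.
have [Fk FkE] : exists Fk : forall k, 'M[C]_(m k),
    forall (k : IV) i j, A (tg k i) (tg k j) = (Fk (val k) i j)%:M.
  have Fk_ex k : exists B : 'M[C]_(m k), forall (kIV : k \in IV) i j,
      A (tg [` kIV]%fset i) (tg [` kIV]%fset j) = (B i j)%:M.
    case: (pselect (k \in IV)) => [kIV|kNIV]; last first.
      (* Outside [IV] the matrix is set to 0. *)
      by exists 0 => kIV; case: (kNIV kIV).
    pose s0 := Ordinal (dimension_gt0 [` kIV]%fset).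
    exists (\matrix_(i, j) A (tg [` kIV]%fset i) (tg [` kIV]%fset j) s0 s0).
    move=> kIV' i j; rewrite (bool_irrelevance kIV' kIV).
    have [a Aa] := A_scalar [` kIV]%fset i j.
    by rewrite [in RHS]mxE Aa [in RHS]mxE eqxx.
  exists (fun k => projT1 (cid (Fk_ex k))) => -[k kIV] i j.
  exact: (projT2 (cid (Fk_ex k)) kIV i j).
(* Only blocks with equal [k] survive. The vectors are arbitrary because both evaluations and test
   vectors are inserted below. *)
have sumE (u v : forall q : Q, 'I_(n q) -> C) :
    \sum_q \sum_r sesq (A q r) (u q) (v r) =
    \sum_(k : IV) \sum_(i < m (val k)) \sum_(j < m (val k))
      sesq (Fk (val k) i j)%:M (u (tg k i)) (v (tg k j)).
  rewrite sum_tagged; apply: eq_bigr => k _; apply: eq_bigr => i _.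
  rewrite sum_tagged (bigD1 k) //= [X in _ + X]big1 ?addr0.
    by apply: eq_bigr => j _; rewrite FkE.
  move=> l lk; apply: big1 => j _; rewrite A_neq0 1?eq_sym//.
  by rewrite /sesq big1// => s _; rewrite big1// => t _; rewrite mxE mul0r.
exists Fk; split=> [k kIV|x y]; last by rewrite zonal_expansion FE sumE.
pose K0 : IV := [` kIV]%fset.
pose s0 := Ordinal (dimension_gt0 K0).
apply/hermitian_psdP; split=> [i j|v].
  (* Hermitian symmetry of [F] passes to the blocks by uniqueness of coefficients; their [(s0, s0)]
     entries give that of [F_k]. *)
  have AE : forall q r, A q r = map_mx conjC (A r q)^T.
    apply: (sesq_family_eq E_independent
      (B := fun q r => map_mx conjC (A r q)^T)).
    move=> x y; rewrite -FE F_herm FE rmorph_sum exchange_big.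
    apply: eq_bigr => q _ /=; rewrite rmorph_sum; apply: eq_bigr => r _ /=.
    by rewrite sesq_conj.
  have := AE (tg K0 i) (tg K0 j); rewrite !FkE => /matrixP/(_ s0 s0).
  by rewrite !mxE eqxx.
(* The test vector [u] has the value [v i] at the first coordinate of the summand [(K0, i)] and 0
   elsewhere, so the form reduces to that of [Fk k] at [v]. Writing [w] as a sum avoids a case
   analysis on the dependent index. *)
pose w q := \sum_(i : 'I_(m (val K0))) v i * (q == tg K0 i)%:R.
have wK0 i : w (tg K0 i) = v i.
  rewrite /w (bigD1 i) //= eqxx mulr1 big1 ?addr0// => j ji.
  by rewrite eq_Tagged /= eq_sym (negbTE ji) mulr0.
pose u (q : Q) (s : 'I_(n q)) := w q * (val s == 0%N)%:R.
have := (sesq_family_psd E_independent (F := fun x y => F (x, y)) FE).1 F_pos u.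
rewrite sumE (bigD1 K0) //= [X in _ + X]big1 ?addr0 => [|l lK0]; last first.
  apply: big1 => i _; apply: big1 => j _.
  rewrite sesq_scalar big1 ?mulr0// => s _.
  rewrite /u /w big1 ?mul0r// => i' _.
  suff -> : (tg l i == tg K0 i') = false by rewrite mulr0.
  by apply: contra_neqF lK0 => /eqP/(congr1 (@tag _ _)).
congr (0 <= _); apply: eq_bigr => i _; apply: eq_bigr => j _.
rewrite sesq_scalar (bigD1 s0) //= big1 ?addr0 => [|s ss0]; last first.
  by rewrite /u (_ : val s == 0%N = false) ?mulr0 ?mul0r//; apply: negbTE.
by rewrite /u !wK0 /= !mulr1.
Qed.

(** * Invariance and positivity of zonal sums *)

Lemma tensor_square_continuous (F : M * M -> C) :
  tensor_square V F -> continuous F.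
Proof.
move=> [N [c [w [wV ->]]]]; apply: continuous_lincomb => a.
have [f1 [f2 [Vf1 Vf2 ->]]] := wV a.
have Vc := V_subspace.1.
apply: (@continuous_mul_conj _ _ (f1 \o fst) (f2 \o snd)) => z.
  by apply: continuous_comp; [exact: cvg_fst|exact: Vc].
by apply: continuous_comp; [exact: cvg_snd|exact: Vc].
Qed.

(** In adapted bases [G] acts by the same unitary matrix for all [i], and scalar blocks are
    unchanged under congruence by it. *)
Lemma zonal_sum_invariant_positive_definite (F : M * M -> C)
    (Fk : forall k, 'M[C]_(m k)) :
  continuous F -> (forall k, k \in IV -> hermitian_psd (Fk k)) ->
  (forall x y, F (x, y) =
     \sum_(k <- IV) mx_inner (Fk k) (map_mx conjC (zonal_mx e k x y))) ->
  G_invariant act F /\ positive_definite F.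
Proof.
move=> F_cont Fk_psd FE; split=> [g x y|].
  rewrite !FE !zonal_expansion; apply: eq_bigr => k _; apply: eq_bigr => i _.
  apply: eq_bigr => j _.
  pose pi (q : Q) := repmx act mu (E q) g^-1%g.
  have E_act (q : Q) z :
      (fun s => E q s (act g z)) = (fun s => \sum_t pi q s t * E q t z).
    apply/funext => s.
    have /(congr1 (fun f => f z)) :=
      fun_act_onb compact_M (H_subspace q) (E_onb q) g^-1%g s.
    by rewrite /fun_act invgK fct_sumE.
  have pi_ij : pi (tg k j) = pi (tg k i).
    apply/matrixP => s t; rewrite !mxE /=.
    by case: e_bases => _; apply; exact: valP.
  rewrite (E_act (tg k i) x) (E_act (tg k j) y).
  rewrite (sesq_mul _ _ _ (fun t => E (tg k i) t x) (fun t => E (tg k j) t y)).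
  rewrite pi_ij; congr sesq.
  have := repmx_unitary compact_M act_continuous mu_invariant
    (H_subspace (tg k i)) (E_onb (tg k i)) g^-1%g.
  (* Commuting the factors and transposing brings unitarity to the form
     [P^T *m map_mx conjC P = 1%:M] that [sesq_mul] produces. *)
  move/mulmx1C => /(congr1 trmx); rewrite trmx_mul trmx1 -map_trmx trmxK => pi1.
  by rewrite -mulmxA mul_scalar_mx -scalemxAr pi1 scalemx1.
split=> // [x y|N x alpha].
  rewrite !FE !zonal_expansion rmorph_sum; apply: eq_bigr => k _.
  rewrite exchange_big rmorph_sum; apply: eq_bigr => i _ /=.
  rewrite rmorph_sum; apply: eq_bigr => j _ /=.
  have [herm _] := (hermitian_psdP (Fk (val k))).1 (Fk_psd _ (valP k)).
  by rewrite sesq_conj tr_scalar_mx map_scalar_mx herm.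
pose u (q : Q) s := \sum_a alpha a * E q s (x a).
have -> : \sum_(a < N) \sum_(b < N) alpha a * F (x a, x b) * (alpha b)^* =
    \sum_(k : IV) \sum_(i < m (val k)) \sum_(j < m (val k))
      sesq (Fk (val k) i j)%:M (u (tg k i)) (u (tg k j)).
  under [RHS]eq_bigr do under eq_bigr do under eq_bigr do rewrite sesq_sum.
  under [RHS]eq_bigr do rewrite pair_big /=.
  under [RHS]eq_bigr do under eq_bigr do rewrite pair_big /=.
  under [RHS]eq_bigr do rewrite exchange_big /=.
  rewrite [RHS]exchange_big pair_big /=; apply: eq_bigr => -[a b] _ /=.
  rewrite FE zonal_expansion mulr_sumr mulr_suml; apply: eq_bigr => k _.
  by rewrite pair_big mulr_sumr mulr_suml.
apply: sumr_ge0 => k _.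
have [_ psd] := (hermitian_psdP (Fk (val k))).1 (Fk_psd _ (valP k)).
(* For fixed [k] and [s] the remaining double sum is the form of [F_k] at the vector with entries
   [u (tg k i) s]. *)
under eq_bigr do under eq_bigr do rewrite sesq_scalar mulr_sumr.
under eq_bigr do rewrite exchange_big /=.
rewrite exchange_big; apply: sumr_ge0 => s _ /=.
exact: psd.
Qed.

End ZonalDecomposition.

Theorem theorem3p3
  (R : realType)
  (G : topologicalGroupType)
  (compact_G : compact [set: G]) (hausdorff_G : hausdorff_space G)
  (M : ptopologicalType)
  (compact_M : compact [set: M]) (hausdorff_M : hausdorff_space M)
  (act : G -> M -> M) (act_continuous : continuous_action act)
  (mu : {finite_measure set (borelType M) -> \bar R})
  (mu_regular : regular_measure mu)
  (mu_invariant : invariant_measure mu act)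
  (mu_positive : positive_on_opens mu)
  (V : set (M -> Cplx R))
  (V_subspace : G_subspace_of_continuous act V)
  (V_findim : finite_dimensional V)
  (K : choiceType) (d : K -> nat) (rho : forall k, G -> 'M[Cplx R]_(d k))
  (rho_irr : irreducible_representatives rho)
  (IV : {fset K}) (m : K -> nat)
  (H : forall k, 'I_(m k) -> set (M -> Cplx R))
  (V_decomposition : orthogonal_decomposition mu act V rho IV H)
  (e : forall k, 'I_(m k) -> 'I_(d k) -> M -> Cplx R)
  (e_bases : adapted_bases mu act IV H e)
  (F : M * M -> Cplx R) (F_V2 : tensor_square V F) :
  (G_invariant act F /\ positive_definite F) <->
  (exists Fk : forall k, 'M[Cplx R]_(m k),
     (forall k, k \in IV -> hermitian_psd (Fk k)) /\
     (forall x y, F (x, y) =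
        \sum_(k <- IV) mx_inner (Fk k) (map_mx conjC (zonal_mx e k x y)))).
Proof.
have rho_noniso := let: And3 _ h _ := rho_irr in h.
split=> [[F_inv F_pd]|[Fk [Fk_psd FE]]].
  exact: (zonal_coefficients compact_M act_continuous mu_invariant rho_noniso
    V_decomposition e_bases F_V2 F_inv F_pd).
(* Continuity is part of [positive_definite]; it comes from membership in [tensor_square V]. *)
have F_cont := tensor_square_continuous V_subspace F_V2.
exact: (zonal_sum_invariant_positive_definite compact_M act_continuous
  mu_invariant V_decomposition e_bases F_cont Fk_psd FE).
Qed.
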